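(* Let $(\mathcal{X},P)$ be a finite irreducible Markov chain with stationary distribution $\pi$. For $t>0$ and $o\in\mathcal{X}$, $$\left\|\log\frac{\mathscr{P}_t(o,\cdot)}{\pi(\cdot)}\right\|_{\mathrm{Lip}}\le k_{(\mathcal{X},P)}\left(\log\Delta(P^* )+\log\left(e-1+\frac{\log\widetilde{\Delta}(\mathscr{P}_t)}{t}\right)\right).$$
   Context: A finite irreducible Markov chain $(\mathcal{X},P)$ consists of a finite set $\mathcal{X}$ with $|\mathcal{X}|\ge2$ and an irreducible stochastic matrix $P$ on $\mathcal{X}$ (no symmetry of the support assumed). $\mathscr{P}_t(x,y)=e^{-t}\sum_{m\ge0}\frac{t^m}{m!}P^m(x,y)$. $P^*$ is the adjoint of $P$ with respect to $\pi$: $P^*(x,y)=\frac{\pi(y)}{\pi(x)}P(y,x)$. For a stochastic matrix $Q$ on $\mathcal{X}$: $\Delta(Q)=\max\{1/Q(x,y):Q(x,y)>0,\ x\ne y\}$ and $\widetilde{\Delta}(Q)=\max\{1/Q(x,y):Q(x,y)>0\}$ (diagonal included). $d_P(x\to y)=\min\{k\in\mathbb{N}_0:P^k(x,y)>0\}$ (with $P^0=I$); $k_{(\mathcal{X},P)}=\max\{d_P(y\to x):d_P(x\to y)=1\}$. For $f:\mathcal{X}\to\mathbb{R}$, $\|f\|_{\mathrm{Lip}}=\max\{|f(u)-f(v)|:d_P(u\to v)\le1\}$. *)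

(* Defs.v *)
From mathcomp Require Export all_boot all_order all_algebra.
From mathcomp Require Export all_classical all_reals all_analysis.

Set Implicit Arguments.
Unset Strict Implicit.
Unset Printing Implicit Defensive.

Import Order.TTheory GRing.Theory Num.Theory.
Import numFieldNormedType.Exports.

Local Open Scope ring_scope.

Definition stochastic (R : realType) (X : finType) (P : X -> X -> R) : Prop :=
  (forall x y, 0 <= P x y) /\ (forall x, \sum_(y : X) P x y = 1).

Fixpoint kpow (R : realType) (X : finType) (P : X -> X -> R) (m : nat)
    (x y : X) : R :=
  if m is m'.+1 then \sum_(z : X) P x z * kpow P m' z y else (x == y)%:R.

Definition irreducible (R : realType) (X : finType) (P : X -> X -> R) : Prop :=
  forall x y, exists k : nat, 0 < kpow P k x y.

Definition stationary (R : realType) (X : finType) (P : X -> X -> R)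
    (pi : X -> R) : Prop :=
  [/\ forall x, 0 <= pi x, \sum_(x : X) pi x = 1
    & forall y, \sum_(x : X) pi x * P x y = pi y].

Definition heat_kernel (R : realType) (X : finType) (P : X -> X -> R) (t : R)
    (x y : X) : R :=
  expR (- t) * limn (series (fun m : nat => t ^+ m / m`!%:R * kpow P m x y)).

Definition adjoint (R : realType) (X : finType) (P : X -> X -> R)
    (pi : X -> R) (x y : X) : R :=
  pi y / pi x * P y x.

(* In the real-valued maxima below all terms are nonnegative, so the default
   value 0 of the iterated operator only matters for an empty index set. *)
Definition Delta (R : realType) (X : finType) (Q : X -> X -> R) : R :=
  \big[Num.max/0]_(p : X * X | (0 < Q p.1 p.2) && (p.1 != p.2)) (1 / Q p.1 p.2).

Definition Delta_tilde (R : realType) (X : finType) (Q : X -> X -> R) : R :=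
  \big[Num.max/0]_(p : X * X | 0 < Q p.1 p.2) (1 / Q p.1 p.2).

(* The irreducibility proof guarantees that the minimum exists; the value does
   not depend on the proof. *)
Definition kdist (R : realType) (X : finType) (P : X -> X -> R)
    (irrP : irreducible P) (x y : X) : nat :=
  ex_minn (irrP x y).

Definition kdist_rev (R : realType) (X : finType) (P : X -> X -> R)
    (irrP : irreducible P) : nat :=
  \max_(p : X * X | kdist irrP p.1 p.2 == 1%N) kdist irrP p.2 p.1.

Definition lip_norm (R : realType) (X : finType) (P : X -> X -> R)
    (irrP : irreducible P) (f : X -> R) : R :=
  \big[Num.max/0]_(p : X * X | (kdist irrP p.1 p.2 <= 1)%N) `|f p.1 - f p.2|.

(* Main.v *)
(* Along an edge x -> y one has P^m(o,x) P(x,y) <= P^(m+1)(o,y), so the heat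
   kernel densities h = p_t(o,.)/pi satisfy
   h(x)/h(y) <= Delta(P^* ) E[N]/t, where N is a Poisson(t) variable tilted by
   m |-> P^m(o,y)/p_t(o,y). As this tilting density is at most 1/p_t(o,y),
   Jensen gives exp(E[N]) <= E[exp N] <= exp(t(e-1))/p_t(o,y), which bounds
   E[N]/t. Summing the logarithms along a path y -> x of length at most k gives
   the opposite inequality. *)
Require Import Defs.
From mathcomp Require Import ring lra.

Set Implicit Arguments.
Unset Strict Implicit.
Unset Printing Implicit Defensive.

Import Order.TTheory GRing.Theory Num.Theory.
Import numFieldNormedType.Exports.

Local Open Scope ring_scope.

(** * Poisson averages of sequences with values in [0, 1] *)

Section PoissonMean.
Context {R : realType}.
Implicit Types (t : R) (a b : nat -> R).

Definition poisson_term t a (m : nat) : R := t ^+ m / m`!%:R * a m.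

(** The expectation of [a N] for a Poisson(t) variable [N]. With [a m = kpow P m x y] it unfolds to
    the heat kernel. *)
Definition poisson_mean t a : R := expR (- t) * limn (series (poisson_term t a)).

Lemma poisson_term_ge0 t a :
  0 <= t -> (forall m, 0 <= a m) -> forall m, 0 <= poisson_term t a m.
Proof.
move=> t0 a0 m; apply: mulr_ge0 => //.
by rewrite divr_ge0 ?exprn_ge0 ?ler0n.
Qed.

Lemma poisson_term_le t a : 0 <= t -> (forall m, a m <= 1) ->
  forall m, poisson_term t a m <= exp_coeff t m.
Proof.
move=> t0 a1 m; rewrite -[leRHS]mulr1 ler_wpM2l//.
by rewrite divr_ge0 ?exprn_ge0 ?ler0n.
Qed.

Lemma is_cvg_poisson_series t a : 0 <= t -> (forall m, 0 <= a m <= 1) ->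
  cvgn (series (poisson_term t a)).
Proof.
move=> t0 a01.
have a0 m : 0 <= a m by case/andP: (a01 m).
have a1 m : a m <= 1 by case/andP: (a01 m).
apply: (series_le_cvg (v_ := exp_coeff t)).
- exact: poisson_term_ge0.
- by move=> m; rewrite /exp_coeff/= divr_ge0 ?exprn_ge0 ?ler0n.
- exact: poisson_term_le.
- exact: is_cvg_series_exp_coeff.
Qed.

Lemma le_poisson_mean t a b : 0 <= t ->
  (forall m, 0 <= a m <= 1) -> (forall m, 0 <= b m <= 1) ->
  (forall m, a m <= b m) -> poisson_mean t a <= poisson_mean t b.
Proof.
move=> t0 a01 b01 ab; rewrite ler_wpM2l ?expR_ge0//.
apply: lim_series_le; [exact: is_cvg_poisson_series..|move=> m].
by rewrite ler_wpM2l// divr_ge0 ?exprn_ge0 ?ler0n.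
Qed.

Lemma poisson_meanMr t a c : 0 <= t -> (forall m, 0 <= a m <= 1) ->
  poisson_mean t (fun m => a m * c) = poisson_mean t a * c.
Proof.
move=> t0 a01; rewrite /poisson_mean -mulrA; congr (_ * _).
have -> : series (poisson_term t (fun m => a m * c)) =
    (fun n => series (poisson_term t a) n * c).
  apply: funext => n; rewrite /series/= mulr_suml.
  by apply: eq_bigr => m _; rewrite /poisson_term mulrA.
apply/cvg_lim => //; apply: cvgMl.
exact: is_cvg_poisson_series.
Qed.

Lemma poisson_mean_le1 t a : 0 <= t -> (forall m, 0 <= a m <= 1) ->
  poisson_mean t a <= 1.
Proof.
move=> t0 a01; rewrite /poisson_mean -[leRHS](expRxMexpNx_1 (- t)) opprK.
rewrite ler_wpM2l ?expR_ge0//; apply: lim_series_le.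
- exact: is_cvg_poisson_series.
- exact: is_cvg_series_exp_coeff.
- by apply: poisson_term_le => // m; case/andP: (a01 m).
Qed.

Lemma poisson_mean_gt0 t a k : 0 < t -> (forall m, 0 <= a m <= 1) ->
  0 < a k -> 0 < poisson_mean t a.
Proof.
move=> t0 a01 ak; rewrite mulr_gt0 ?expR_gt0//.
have term0 : forall m, 0 <= poisson_term t a m.
  by apply: poisson_term_ge0 => [|m]; [exact: ltW|case/andP: (a01 m)].
apply: (@lt_le_trans _ _ (series (poisson_term t a) k.+1)); last first.
  apply: nondecreasing_cvgn_le.
    by apply: nondecreasing_series => n _ _.
  by apply: is_cvg_poisson_series => //; exact: ltW.
rewrite /series/= big_nat_recr//= ltr_wpDl ?sumr_ge0//.
by rewrite mulr_gt0// divr_gt0 ?exprn_gt0// ltr0n fact_gt0.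
Qed.

(** Size-biasing E[N a(N)] = t E[a(N+1)] for truncated sums, from m / m! = 1 / (m-1)!. The term at 0
    vanishes, so n+1 terms on the left match n on the right. *)
Lemma series_poisson_shift t a n :
  \sum_(0 <= m < n.+1) m%:R * poisson_term t a m =
  t * \sum_(0 <= m < n) poisson_term t (fun m => a m.+1) m.
Proof.
rewrite big_nat_recl// mul0r add0r mulr_sumr; apply: eq_bigr => m _.
rewrite /poisson_term factS natrM exprS invfM.
have m0 : m.+1%:R != 0 :> R by rewrite pnatr_eq0.
by move: (m`!%:R^-1) => f; field.
Qed.

(* For the Poisson(t) law of m weighted by a, this is the convexity bound
   (E exp m >= exp (E m)) in its tangent-line form at s. *)
Lemma poisson_tangent t a s : 0 <= t -> (forall m, 0 <= a m <= 1) ->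
  expR s * ((1 - s) * poisson_mean t a
            + t * poisson_mean t (fun m => a m.+1)) <= expR (t * (expR 1 - 1)).
Proof.
move=> t0 a01; rewrite /poisson_mean.
set A := poisson_term t a; set B := poisson_term t (fun m => a m.+1).
have cA : cvgn (series A) by exact: is_cvg_poisson_series.
have cB : cvgn (series B) by exact: is_cvg_poisson_series.
(* The cut-offs n+1 and n make the size-biasing identity exact. The factor exp(-t) is restored only
   after the limit. *)
have partial n : expR s * ((1 - s) * series A n.+1 + t * series B n)
    <= expR (t * expR 1).
  rewrite /series/= -series_poisson_shift mulr_sumr -big_split/= mulr_sumr.
  apply: (@le_trans _ _ (series (exp_coeff (t * expR 1)) n.+1)); last first.
    apply: nondecreasing_cvgn_le; last exact: is_cvg_series_exp_coeff.
    apply: nondecreasing_series => m _ _.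
    by rewrite /exp_coeff/= divr_ge0 ?exprn_ge0 ?mulr_ge0 ?expR_ge0 ?ler0n.
  apply: ler_sum => m _.
  rewrite /exp_coeff/= exprMn -expRM_natl mulr1.
  have -> : t ^+ m * expR m%:R / m`!%:R = t ^+ m / m`!%:R * expR m%:R by ring.
  have -> : expR s * ((1 - s) * A m + m%:R * A m)
      = t ^+ m / m`!%:R * (a m * (expR s * (1 + (m%:R - s)))).
    by rewrite /A /poisson_term; ring.
  rewrite ler_wpM2l ?divr_ge0 ?exprn_ge0 ?ler0n//.
  (* The tangent line to exp at [s], evaluated at [m]; afterwards the weight [a m] is dropped, being
     at most 1. *)
  have le_exp : expR s * (1 + (m%:R - s)) <= expR m%:R.
    rewrite (_ : expR m%:R = expR s * expR (m%:R - s)); last first.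
      by rewrite -expRD; congr expR; ring.
    by rewrite ler_wpM2l ?expR_ge0 ?expR_ge1Dx.
  case/andP: (a01 m) => am0 am1.
  apply: (@le_trans _ _ (a m * expR m%:R)); first by rewrite ler_wpM2l.
  by rewrite -[leRHS]mul1r ler_wpM2r ?expR_ge0.
have lim_le : expR s * ((1 - s) * limn (series A) + t * limn (series B))
    <= expR (t * expR 1).
  have cvg_partial : (expR s * ((1 - s) * series A n.+1 + t * series B n)
      @[n --> \oo] -->
      expR s * ((1 - s) * limn (series A) + t * limn (series B)))%classic.
    apply: cvgMr; apply: cvgD; apply: cvgMr => //.
    by rewrite (cvg_shiftS (series A)).
  rewrite -(cvg_lim _ cvg_partial)//; apply: limr_le.
    by apply/cvg_ex; eexists; exact: cvg_partial.
  exact: nearW partial.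
rewrite mulrBr mulr1 expRD mulrC [leRHS]mulrC.
have -> : ((1 - s) * (expR (- t) * limn (series A))
    + t * (expR (- t) * limn (series B))) * expR s
  = expR (- t) * (expR s * ((1 - s) * limn (series A) + t * limn (series B))).
  by ring.
by rewrite ler_wpM2l ?expR_ge0.
Qed.

(** By size-biasing, t times the ratio of the two means is the mean of N under the tilted law;
    Jensen bounds it by the logarithm of exp(t(e-1)) / Z, where Z is the mean of [a]. *)
Lemma poisson_mean_shift_le t a : 0 < t -> (forall m, 0 <= a m <= 1) ->
  0 < poisson_mean t a ->
  poisson_mean t (fun m => a m.+1)
    <= poisson_mean t a * (expR 1 - 1 - ln (poisson_mean t a) / t).
Proof.
move=> t0 a01 Z0; set Z := poisson_mean t a in Z0 *.
set S := poisson_mean t _.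
(* For this s, exp(s) = exp(t(e-1)) / Z, so the tangent inequality reduces to (1-s) Z + t S <= Z,
   that is, t S <= s Z. *)
have := @poisson_tangent t a (t * (expR 1 - 1) - ln Z) (ltW t0) a01.
rewrite -/Z -/S expRD expRN lnK// -mulrA ger_pMr ?expR_gt0// mulrC.
rewrite ler_pdivrMr// mul1r => tangent.
rewrite -(ler_pM2l t0).
have -> : t * (Z * (expR 1 - 1 - ln Z / t))
    = Z * (t * (expR 1 - 1) - ln Z).
  by field; rewrite gt_eqF.
lra.
Qed.

End PoissonMean.

(** * Powers of a stochastic kernel and its heat kernel *)

Section Kernel.
Context {R : realType} {X : finType}.
Variable P : X -> X -> R.

(** [kpow] splits off the first step; appending an edge at the end of a path needs the last one. *)
Lemma kpowSr m x y : kpow P m.+1 x y = \sum_z kpow P m x z * P z y.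
Proof.
elim: m x => [|m IHm] x /=.
  rewrite (bigD1 y)//= eqxx mulr1 big1 => [|z /negPf->]; last by rewrite mulr0.
  rewrite (bigD1 x)//= eqxx mul1r big1 => [|z]; first by [].
  by rewrite eq_sym => /negPf->; rewrite mul0r.
under eq_bigr do rewrite -/(kpow P m.+1 _ _) IHm mulr_sumr.
rewrite exchange_big/=; apply: eq_bigr => z _.
by rewrite mulr_suml; apply: eq_bigr => w _; rewrite mulrA.
Qed.

Hypothesis stochP : stochastic P.

Lemma kpow_ge0 m x y : 0 <= kpow P m x y.
Proof.
elim: m x => [|m IHm] x /=; first exact: ler0n.
by apply: sumr_ge0 => z _; rewrite mulr_ge0 ?stochP.1.
Qed.

Lemma sum_kpow m x : \sum_y kpow P m x y = 1.
Proof.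
elim: m x => [|m IHm] x /=.
  rewrite (bigD1 x)//= eqxx big1 ?addr0// => y.
  by rewrite eq_sym => /negPf->.
rewrite exchange_big/= -[RHS](stochP.2 x); apply: eq_bigr => z _.
by rewrite -mulr_sumr IHm mulr1.
Qed.

Lemma kpow_le1 m x y : kpow P m x y <= 1.
Proof.
rewrite -(sum_kpow m x) (bigD1 y)//= lerDl sumr_ge0// => z _.
exact: kpow_ge0.
Qed.

Lemma kpow01 x y m : 0 <= kpow P m x y <= 1.
Proof. by rewrite kpow_ge0 kpow_le1. Qed.

Lemma kpow1 x y : kpow P 1 x y = P x y.
Proof.
rewrite /= (bigD1 y)//= eqxx mulr1 big1 ?addr0// => z /negPf->.
by rewrite mulr0.
Qed.

Lemma kernel_le1 x y : P x y <= 1.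
Proof. by rewrite -kpow1 kpow_le1. Qed.

Lemma ler_kpowSr m x y z : kpow P m x y * P y z <= kpow P m.+1 x z.
Proof.
rewrite kpowSr (bigD1 y)//= lerDl sumr_ge0// => w _.
by rewrite mulr_ge0 ?kpow_ge0 ?stochP.1.
Qed.

Lemma heat_kernelE t x y :
  heat_kernel P t x y = poisson_mean t (fun m => kpow P m x y).
Proof. by []. Qed.

Lemma heat_kernel_le1 t x y : 0 <= t -> heat_kernel P t x y <= 1.
Proof.
by move=> t0; rewrite heat_kernelE poisson_mean_le1// => m; exact: kpow01.
Qed.

(** * Irreducibility, positivity of the stationary law, and the adjoint *)

Section Irreducible.
Hypothesis irrP : irreducible P.

Lemma heat_kernel_gt0 t x y : 0 < t -> 0 < heat_kernel P t x y.
Proof.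
move=> t0; have [k Pk] := irrP x y; rewrite heat_kernelE.
exact: (poisson_mean_gt0 t0 (kpow01 x y) Pk).
Qed.

Lemma kdist_spec x y : 0 < kpow P (kdist irrP x y) x y.
Proof. by rewrite /kdist; case: ex_minnP. Qed.

Lemma kpow_gt0S k x y : 0 < kpow P k.+1 x y ->
  exists z, 0 < P x z /\ 0 < kpow P k z y.
Proof.
move=> Pk; suff : [exists z, (0 < P x z) && (0 < kpow P k z y)].
  by case/existsP => z /andP[]; exists z.
apply/contraT; rewrite negb_exists => /forallP noz.
move: Pk; rewrite /= big1 ?ltxx// => z _.
move: (noz z); rewrite negb_and -!leNgt => /orP[Pxz|Pzy].
- by rewrite (_ : P x z = 0) ?mul0r//; apply/eqP; rewrite eq_le Pxz stochP.1.
- rewrite (_ : kpow P k z y = 0) ?mulr0//.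
  by apply/eqP; rewrite eq_le Pzy kpow_ge0.
Qed.

(** On a path joining two distinct points, the first step that is not a loop works. This keeps the
    maximum in [Delta] from being its default 0. *)
Lemma exists_edge : (2 <= #|X|)%N -> exists x y, x != y /\ 0 < P x y.
Proof.
case/card_gt1P => x [y [_ _ xy]].
have [k] := irrP x y; elim: k x xy => [|k IHk] x xy.
  by rewrite /= (negPf xy) ltxx.
case/kpow_gt0S => z [Pxz Pzy].
have [eq_xz|] := eqVneq x z; last by exists x, z.
by apply: (IHk x); rewrite ?eq_xz// -eq_xz.
Qed.

Variable pi : X -> R.
Hypothesis statpi : stationary P pi.

Lemma stationary_kpow k y : \sum_x pi x * kpow P k x y = pi y.
Proof.
case: statpi => _ _ statP; elim: k y => [|k IHk] y /=.
  rewrite (bigD1 y)//= eqxx mulr1 big1 ?addr0// => x /negPf->.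
  by rewrite mulr0.
under eq_bigr do rewrite mulr_sumr.
rewrite exchange_big/= -IHk; apply: eq_bigr => z _.
by rewrite -[in RHS]statP mulr_suml; apply: eq_bigr => x _; rewrite mulrA.
Qed.

(** Some point has positive mass, and invariance under a suitable power of [P] carries part of it to
    [y]. *)
Lemma stationary_gt0 y : 0 < pi y.
Proof.
case: (statpi) => pi0 pi1 _.
have [x pix] : exists x, 0 < pi x.
  suff : [exists x, 0 < pi x] by case/existsP => x; exists x.
  apply/contraT; rewrite negb_exists => /forallP nox.
  have : \sum_x pi x <= 0 by apply: sumr_le0 => x _; rewrite leNgt nox.
  by rewrite pi1 ler10.
have [k Pk] := irrP x y.
rewrite -(stationary_kpow k y) (bigD1 x)//= ltr_pwDl ?mulr_gt0//.
by apply: sumr_ge0 => z _; rewrite mulr_ge0 ?kpow_ge0.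
Qed.

(** The flow [pi y * P y x] is one term of the stationarity sum for [pi x]. *)
Lemma adjoint_le1 x y : adjoint P pi x y <= 1.
Proof.
case: (statpi) => pi0 _ statP.
rewrite /adjoint mulrAC ler_pdivrMr ?stationary_gt0// mul1r.
rewrite -[leRHS]statP (bigD1 y)//= lerDl sumr_ge0// => z _.
by rewrite mulr_ge0 ?stochP.1.
Qed.

Lemma adjoint_gt0 x y : 0 < P x y -> 0 < adjoint P pi y x.
Proof. by move=> Pxy; rewrite mulr_gt0// divr_gt0 ?stationary_gt0. Qed.

Lemma Delta_adjoint_ge x y : x != y -> 0 < P x y ->
  1 / adjoint P pi y x <= Delta (adjoint P pi).
Proof.
move=> xy Pxy; rewrite /Delta.
apply: (@le_bigmax_cond _ _ _ 0 (y, x) _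
  (fun p : X * X => 1 / adjoint P pi p.1 p.2)).
by rewrite /= adjoint_gt0// eq_sym.
Qed.

Lemma Delta_adjoint_ge1 : (2 <= #|X|)%N -> 1 <= Delta (adjoint P pi).
Proof.
case/exists_edge => x [y [xy Pxy]].
apply: le_trans (Delta_adjoint_ge xy Pxy).
by rewrite div1r invf_ge1 ?adjoint_gt0 ?adjoint_le1.
Qed.

(** * Increments of the log-density along edges and paths *)

Section HeatRatio.
Variable t : R.
Hypothesis t_gt0 : 0 < t.

(** For t > 0 every entry of the heat kernel is positive, so the maximum runs over all pairs. *)
Lemma Delta_tilde_heat_ge x y :
  (heat_kernel P t x y)^-1 <= Delta_tilde (heat_kernel P t).
Proof.
rewrite /Delta_tilde -div1r.
apply: (@le_bigmax_cond _ _ _ 0 (x, y) _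
  (fun p : X * X => 1 / heat_kernel P t p.1 p.2)).
exact: heat_kernel_gt0.
Qed.

Lemma Delta_tilde_heat_ge1 (x : X) : 1 <= Delta_tilde (heat_kernel P t).
Proof.
apply: le_trans (Delta_tilde_heat_ge x x).
by rewrite invf_ge1 ?heat_kernel_gt0 ?heat_kernel_le1 ?ltW.
Qed.

(** The bound on E[N] / t, made uniform over the endpoints of the heat kernel. *)
Let entropy_rate := expR 1 - 1 + ln (Delta_tilde (heat_kernel P t)) / t.

Lemma entropy_rate_ge1 (x : X) : 1 <= entropy_rate.
Proof.
have := expR_ge1Dx (1 : R).
have : 0 <= ln (Delta_tilde (heat_kernel P t)) / t.
  apply: divr_ge0; last exact: ltW.
  exact: ln_ge0 (Delta_tilde_heat_ge1 x).
rewrite /entropy_rate; lra.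
Qed.

(* [P^m(o,x) P(x,y) <= P^(m+1)(o,y)], and passing from [m] to [m + 1] costs the
   size-biasing factor bounded in [poisson_mean_shift_le]. *)
Lemma heat_kernel_edge o x y :
  heat_kernel P t o x * P x y <= heat_kernel P t o y * entropy_rate.
Proof.
have Z0 := heat_kernel_gt0 o y t_gt0.
rewrite heat_kernelE -(poisson_meanMr _ (ltW t_gt0) (kpow01 o x)).
apply: (@le_trans _ _ (poisson_mean t (fun m => kpow P m.+1 o y))).
  apply: le_poisson_mean => [|m|m|m].
  - exact: ltW.
  - by rewrite mulr_ge0 ?mulr_ile1 ?kpow_ge0 ?kpow_le1 ?kernel_le1 ?stochP.1.
  - exact: kpow01.
  - exact: ler_kpowSr.
apply: (le_trans (poisson_mean_shift_le t_gt0 (kpow01 o y) Z0)).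
rewrite -heat_kernelE ler_pM2l// lerD2l -mulNr ler_pM2r ?invr_gt0//.
rewrite -lnV ?posrE// ler_ln ?posrE ?invr_gt0 ?Delta_tilde_heat_ge//.
exact: lt_le_trans ltr01 (Delta_tilde_heat_ge1 o).
Qed.

Let log_density o x := ln (heat_kernel P t o x / pi x).
Let edge_bound := ln (Delta (adjoint P pi)) + ln entropy_rate.

(** Covers loops, and lets a bound for a short path be relaxed to one for a longer path. *)
Lemma edge_bound_ge0 : (2 <= #|X|)%N -> 0 <= edge_bound.
Proof.
move=> cardX; have [x _] := exists_edge cardX.
apply: addr_ge0; apply: ln_ge0; first exact: Delta_adjoint_ge1.
exact: entropy_rate_ge1 x.
Qed.

Lemma log_density_edge o x y : (2 <= #|X|)%N -> 0 < P x y ->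
  log_density o x - log_density o y <= edge_bound.
Proof.
move=> cardX Pxy; have [<-|xy] := eqVneq x y.
  by rewrite subrr edge_bound_ge0.
have [pix piy] := (stationary_gt0 x, stationary_gt0 y).
have D0 : 0 < Delta (adjoint P pi).
  exact: lt_le_trans ltr01 (Delta_adjoint_ge1 cardX).
have E0 : 0 < entropy_rate := lt_le_trans ltr01 (entropy_rate_ge1 x).
move: (heat_kernel_edge o x y) (heat_kernel_gt0 o x t_gt0)
  (heat_kernel_gt0 o y t_gt0).
rewrite lerBlDr /edge_bound /log_density.
move: (heat_kernel P t o x) (heat_kernel P t o y) => u v edge u0 v0.
have u_pi0 := divr_gt0 u0 pix; have v_pi0 := divr_gt0 v0 piy.
rewrite -!lnM ?posrE ?(mulr_gt0 D0 E0)//.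
rewrite ler_ln ?posrE// ?(mulr_gt0 (mulr_gt0 D0 E0))//.
(* Since [1 / adjoint P pi y x] equals [pi y / (pi x * P x y)], the factor [pi y] cancels and the
   edge inequality divided by [P x y * pi x] remains. *)
apply: (@le_trans _ _ (1 / adjoint P pi y x * entropy_rate * (v / pi y))).
  have -> : 1 / adjoint P pi y x * entropy_rate * (v / pi y)
      = v * entropy_rate / P x y / pi x.
    by rewrite /adjoint; field; rewrite !gt_eqF.
  by rewrite ler_pM2r ?invr_gt0// ler_pdivlMr.
by rewrite ler_pM2r// ler_pM2r// Delta_adjoint_ge.
Qed.

Lemma log_density_path o k x y : (2 <= #|X|)%N -> 0 < kpow P k x y ->
  log_density o x - log_density o y <= k%:R * edge_bound.
Proof.
move=> cardX; elim: k x => [|k IHk] x.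
  rewrite /=; have [->|] := eqVneq x y; last by rewrite ltxx.
  by rewrite subrr mul0r.
case/kpow_gt0S => z [Pxz /IHk]; have := log_density_edge o cardX Pxz.
rewrite -[k.+1]addn1 natrD; lra.
Qed.

End HeatRatio.
End Irreducible.
End Kernel.

Theorem lemma2p3 (R : realType) (X : finType) (cardX : (2 <= #|X|)%N)
    (P : X -> X -> R) (stochP : stochastic P) (irrP : irreducible P)
    (pi : X -> R) (statpi : stationary P pi)
    (t : R) (t_gt0 : 0 < t) (o : X) :
  lip_norm irrP (fun x => ln (heat_kernel P t o x / pi x)) <=
  (kdist_rev irrP)%:R *
    (ln (Delta (adjoint P pi)) +
     ln (expR 1 - 1 + ln (Delta_tilde (heat_kernel P t)) / t)).
Proof.
have L0 := edge_bound_ge0 stochP irrP statpi t_gt0 cardX.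
have path k x y :=
  @log_density_path R X P stochP irrP pi statpi t t_gt0 o k x y cardX.
have bound_ge0 := mulr_ge0 (ler0n R (kdist_rev irrP)) L0.
apply: bigmax_le => [//|[x y] /=].
(* Distance 0 forces [x = y], where the increment vanishes; distance 1 is the real case. *)
rewrite leq_eqVlt ltnS leqn0 => /orP[/eqP dxy|/eqP dxy]; last first.
  have := kdist_spec irrP x y; rewrite dxy /=.
  by have [->|] := eqVneq x y; rewrite ?ltxx// subrr normr0.
have le_rev : (kdist irrP y x <= kdist_rev irrP)%N.
  apply: (@leq_bigmax_cond _ (fun p : X * X => kdist irrP p.1 p.2 == 1)
            (fun p => kdist irrP p.2 p.1) (x, y)).
  by rewrite /= dxy.
(* The forward direction costs one [edge_bound], so the factor [kdist_rev irrP] must be at least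
   1. *)
have rev_gt0 : (0 < kdist irrP y x)%N.
  rewrite lt0n; apply/eqP => dyx.
  have := kdist_spec irrP y x; rewrite dyx /=.
  have [yx _|] := eqVneq y x; last by rewrite ltxx.
  by move: dyx; rewrite yx -{2}yx dxy.
rewrite ler_norml lerNl opprB; apply/andP; split.
- apply: le_trans (path _ y x (kdist_spec irrP y x)) _.
  by rewrite ler_wpM2r// ler_nat.
- apply: le_trans (path _ x y (kdist_spec irrP x y)) _.
  by rewrite dxy ler_wpM2r// ler_nat (leq_trans rev_gt0).
Qed.
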